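(* Let $\mathcal H$ be a real separable Hilbert space and $(L,\mathcal D(L))$ a densely defined, self-adjoint, positive semi-definite linear operator on $\mathcal H$ with spectrum $\sigma(L)$. Put $\lambda_0:=\inf\sigma(L)$ and $\lambda_1:=\inf(\sigma(L)\setminus\{\lambda_0\})$. Assume that $\nu:=\lambda_1-\lambda_0>0$ and that the eigenspace of $L$ corresponding to $\lambda_0$ is one-dimensional; let $\varphi\in\mathcal D(L)$ with $\|\varphi\|=1$ and $L\varphi=\lambda_0\varphi$. Let $H:\mathcal H\to\mathcal H$ be a bounded self-adjoint linear operator whose operator norm satisfies $\|H\|<\nu/2$, and let $\widehat L:=L+H$ with domain $\mathcal D(L)$. Let $\widehat\varphi$ be the unit-norm eigenfunction of $\widehat L$ with eigenvalue $\widehat\lambda_0:=\inf\{\langle f,\widehat Lf\rangle: f\in\mathcal D(L),\|f\|=1\}$ (it exists and is unique up to sign), with its sign chosen such that $\langle\varphi,\widehat\varphi\rangle\ge 0$. Then $$\|\varphi-\widehat\varphi\|\le\frac{\|H\varphi\|}{\nu-2\|H\|}.$$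
   Context: $\langle\cdot,\cdot\rangle$ and $\|\cdot\|$ denote the inner product and norm of $\mathcal H$; $\|H\|$ is the operator norm. Positive semi-definite means $\langle Lf,f\rangle\ge0$ for all $f\in\mathcal D(L)$, so that $\sigma(L)\subset[0,\infty)$ is nonempty. When $\nu>0$, $\lambda_0$ is an eigenvalue of $L$. *)

(* Defs.v *)
From HB Require Import structures.
From mathcomp Require Import all_boot all_order all_algebra.
From mathcomp Require Import sesquilinear.
From mathcomp Require Import all_classical all_reals all_analysis.

Set Implicit Arguments.
Unset Strict Implicit.
Unset Printing Implicit Defensive.

Import Order.TTheory GRing.Theory Num.Theory.
Import numFieldNormedType.Exports.

Local Open Scope classical_set_scope.
Local Open Scope ring_scope.

(* A real Hilbert space is a complete normed module V over R together with a
   symmetric positive definite form dot that induces the norm of V. *)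
Definition induces_norm (R : realType) (V : completeNormedModType R)
    (dot : {dot V for idfun}) : Prop :=
  forall u : V, `|u| ^+ 2 = dot u u.

Definition separable_space (T : topologicalType) : Prop :=
  exists2 A : set T, countable A & dense A.

(* The underlying function is total; only its values on the domain matter, and
   every notion below restricts to the domain. *)
Record partial_operator (R : realType) (V : completeNormedModType R) :=
  PartialOperator {
    op_domain : set V;
    op_action :> V -> V;
    op_domain_zero : op_domain 0;
    op_domain_linear : forall (a : R) (u v : V),
      op_domain u -> op_domain v -> op_domain (a *: u + v);
    op_action_linear : forall (a : R) (u v : V),
      op_domain u -> op_domain v ->
      op_action (a *: u + v) = a *: op_action u + op_action v
  }.

Section Operators.
Context {R : realType} {V : completeNormedModType R}.
Implicit Types (L : partial_operator V) (T H : {linear V -> V}).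
Implicit Type dot : {dot V for idfun}.

Definition op_graph L : set (V * V) :=
  [set p | op_domain L p.1 /\ p.2 = L p.1].

(* This is the graph of the adjoint when the domain of L is dense. *)
Definition op_adjoint_graph dot L : set (V * V) :=
  [set p | forall f, op_domain L f -> dot (L f) p.1 = dot f p.2].

Definition self_adjoint dot L : Prop := op_graph L = op_adjoint_graph dot L.

Definition positive_semidefinite dot L : Prop :=
  forall f, op_domain L f -> 0 <= dot f (L f).

Definition bounded_op T : Prop := bounded_near T (nbhs (0 : V)).

Definition bounded_self_adjoint dot T : Prop :=
  bounded_op T /\ forall f g, dot (T f) g = dot f (T g).

Definition op_norm T : R := sup [set `|T f| | f in [set f : V | `|f| <= 1]].

(* L - z maps its domain bijectively onto V, with bounded inverse T. *)
Definition resolvent_set L : set R :=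
  [set z | exists T, [/\ bounded_op T,
      forall g, op_domain L (T g),
      forall g, L (T g) - z *: T g = g &
      forall f, op_domain L f -> T (L f - z *: f) = f]].

Definition spectrum L : set R := ~` resolvent_set L.

Definition lambda0 L : R := inf (spectrum L).

(* Extended real: +oo when the spectrum is reduced to lambda0. *)
Definition lambda1 L : \bar R :=
  ereal_inf (EFin @` (spectrum L `\ lambda0 L)).

Definition spectral_gap L : \bar R := (lambda1 L - (lambda0 L)%:E)%E.

Definition op_eigenspace L (z : R) : set V :=
  [set f | op_domain L f /\ L f = z *: f].

Definition one_dimensional (E : set V) : Prop :=
  exists2 e : V, e != 0 & E = range (fun a : R => a *: e).

Lemma perturbation_linear L H (a : R) (u v : V) :
  op_domain L u -> op_domain L v ->
  L (a *: u + v) + H (a *: u + v) = a *: (L u + H u) + (L v + H v).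
Proof.
move=> Du Dv; rewrite (op_action_linear a Du Dv) linearP scalerDr.
by rewrite addrACA.
Qed.

(* The operator L + H, with the domain of L. *)
Definition perturbation L H : partial_operator V :=
  @PartialOperator R V (op_domain L) (fun f => L f + H f) (op_domain_zero L)
    (@op_domain_linear R V L) (@perturbation_linear L H).

Definition numerical_range_inf dot L : R :=
  inf [set dot f (L f) | f in [set f | op_domain L f /\ `|f| = 1]].

Definition unit_eigenvector L (z : R) (f : V) : Prop :=
  `|f| = 1 /\ op_eigenspace L z f.

End Operators.

(* Main.v *)
Require Import Defs.
From HB Require Import structures.
From mathcomp Require Import all_boot all_order all_algebra.
From mathcomp Require Import sesquilinear.
From mathcomp Require Import all_classical all_reals all_analysis.
From mathcomp Require Import ring lra.

Import Order.TTheory GRing.Theory Num.Theory.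
Import numFieldNormedType.Exports.

Local Open Scope classical_set_scope.
Local Open Scope ring_scope.

(** Write A for L - lambda0 and B for L + H - lambdahat0; both are positive
semi-definite and self-adjoint. Everything rests on one inequality: on the
orthogonal complement of phi, B is bounded below by delta = nu - 2 * op_norm H
> 0. Indeed L >= lambda0 + nu there ([form_gap_lambda0]), the perturbation
costs at most op_norm H, and lambdahat0 <= <phi, (L + H) phi> <= lambda0 +
op_norm H.

- Existence ([min_eigenvector]). A minimizing sequence, scaled so that its
  component along phi is phi itself, has differences orthogonal to phi; the
  inequality makes it Cauchy. Its limit is in the kernel of B, because B is
  closed.
- Uniqueness ([kernel_unique]). Of two vectors in the kernel of B some
  nontrivial combination is orthogonal to phi, hence is zero.
- Distance ([kernel_dist]). If psi = a phi + g with g orthogonal to phi, then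
  delta |g|^2 <= <g, B g> = - a <g, H phi>. So the tangent of the angle between
  phi and psi is at most |H phi| / delta, and the chord |phi - psi| of an acute
  angle is at most its tangent.

The spectral facts about L are obtained without the spectral theorem. A
positive semi-definite form b is strictly positive as soon as every f has a
partner g with b f g = <f, f> and b g g <= K <f, f>: this is Cauchy-Schwarz
([coercive_of_right_inverse]). Applied to |(A - c) f|^2 - r^2 |f|^2, it shows
that |(A - c) f| is at least |f| times the distance from c to the spectrum
([resolvent_dist]). Letting c tend to -oo gives L >= lambda0
([form_ge_lambda0]); taking c at the middle of the gap gives nu <f, A f> <= |A
f|^2 ([form_gap]). The latter implies A >= nu on the range of A, and that range
is dense in the orthogonal complement of the kernel ([form_gap_orthogonal]).

If the gap is infinite, the estimate holds with every real nu, which forces phi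
= phihat. *)

Set Implicit Arguments.
Unset Strict Implicit.
Unset Printing Implicit Defensive.

(** * Positive semi-definite forms on a subspace *)

Section PsdForms.
Context {R : realType} {V : lmodType R}.

Record psd_form (D : set V) (b : V -> V -> R) : Prop := PsdForm {
  psd_domain : forall a f g, D f -> D g -> D (a *: f + g);
  psd_linear : forall a f g h, D f -> D g -> D h ->
    b (a *: f + g) h = a * b f h + b g h;
  psd_sym : forall f g, D f -> D g -> b f g = b g f;
  psd_ge0 : forall f, D f -> 0 <= b f f
}.

Lemma psd_sqr D b a f g : psd_form D b -> D f -> D g ->
  b (a *: f + g) (a *: f + g) = a ^+ 2 * b f f + 2 * a * b f g + b g g.
Proof.
move=> B Df Dg; have Dfg := psd_domain B a Df Dg.
rewrite (psd_linear B)// !(psd_sym B _ Dfg)// !(psd_linear B)//.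
by rewrite (psd_sym B Dg Df); ring.
Qed.

Lemma psd_Cauchy_Schwarz D b f g : psd_form D b -> D f -> D g ->
  b f g ^+ 2 <= b f f * b g g.
Proof.
move=> B Df Dg.
have pos a : 0 <= a ^+ 2 * b f f + 2 * a * b f g + b g g.
  by rewrite -(psd_sqr a B Df Dg); apply: (psd_ge0 B); exact: (psd_domain B).
have := psd_ge0 B Df; rewrite le_eqVlt => /predU1P[ff0|ff_gt0]; last first.
  have := pos (- (b f g / b f f)).
  have -> : (- (b f g / b f f)) ^+ 2 * b f f + 2 * - (b f g / b f f) * b f g
      + b g g = (b f f * b g g - b f g ^+ 2) / b f f.
    by field; rewrite gt_eqF.
  by rewrite pmulr_lge0 ?invr_gt0// subr_ge0.
have [->|fg0] := eqVneq (b f g) 0; first by rewrite -ff0 mul0r expr0n.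
have := pos (- ((b g g + 1) / (2 * b f g))).
have -> : (- ((b g g + 1) / (2 * b f g))) ^+ 2 * b f f
    + 2 * - ((b g g + 1) / (2 * b f g)) * b f g + b g g = -1.
  by rewrite -ff0; field.
by rewrite ler0N1.
Qed.

(** The parallelogram identity, without the value at f + g. *)
Lemma psd_sub_le D b f g : psd_form D b -> D f -> D g ->
  b (f - g) (f - g) <= 2 * (b f f + b g g).
Proof.
move=> B Df Dg; have Dfg := psd_domain B 1 Df Dg.
have -> : f - g = (-1) *: g + f by rewrite scaleN1r addrC.
have := psd_ge0 B Dfg; rewrite !(psd_sqr _ B)// (psd_sym B Dg Df); nra.
Qed.

End PsdForms.

(** * Inner product and coercivity *)

Section Hilbert.
Context {R : realType} {V : completeNormedModType R} (dot : {dot V for idfun}).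
Hypothesis V_hilbert : induces_norm dot.
Implicit Types (L A : partial_operator V) (T : {linear V -> V}).

Lemma dotC u v : dot u v = dot v u.
Proof. by rewrite hermC expr0 mul1r. Qed.

Lemma dotDr u v w : dot u (v + w) = dot u v + dot u w.
Proof. exact: linearDr. Qed.

Lemma dotZr a u v : dot u (a *: v) = a * dot u v.
Proof. by rewrite linearZr_LR. Qed.

Lemma dotNr u v : dot u (- v) = - dot u v.
Proof. exact: linearNr. Qed.

Lemma dotDl u v w : dot (u + v) w = dot u w + dot v w.
Proof. exact: linearDl. Qed.

Lemma dotZl a u v : dot (a *: u) v = a * dot u v.
Proof. by rewrite linearZl_LR. Qed.

Lemma dotNl u v : dot (- u) v = - dot u v.
Proof. exact: linearNl. Qed.

Lemma dot0r u : dot u 0 = 0. Proof. exact: linear0r. Qed.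

Lemma dot0l u : dot 0 u = 0. Proof. exact: linear0l. Qed.

Definition dotE := (dotDl, dotDr, dotNl, dotNr, dotZl, dotZr).

Lemma dot_psd : psd_form [set: V] dot.
Proof.
split=> [//|a f g h _ _ _|f g _ _|f _]; first by rewrite !dotE.
- exact: dotC.
- by rewrite -V_hilbert sqr_ge0.
Qed.

Lemma dot_Cauchy_Schwarz u v : `|dot u v| <= `|u| * `|v|.
Proof.
rewrite -ler_sqr ?nnegrE ?mulr_ge0// exprMn !V_hilbert real_normK ?num_real//.
exact: (psd_Cauchy_Schwarz dot_psd).
Qed.

Lemma dot_le u v : dot u v <= `|u| * `|v|.
Proof. exact: le_trans (ler_norm _) (dot_Cauchy_Schwarz u v). Qed.

(** Polarization reduces this to the continuity of the norm. *)
Lemma dot_cvg (u v : nat -> V) (l m : V) :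
  u @ \oo --> l -> v @ \oo --> m -> dot (u n) (v n) @[n --> \oo] --> dot l m.
Proof.
have polar x y : dot x y = 2^-1 * (`|x + y| ^+ 2 - `|x| ^+ 2 - `|y| ^+ 2).
  by rewrite !V_hilbert !dotE (dotC y x); field.
move=> ul vm; rewrite polar; under eq_fun do rewrite polar.
have sqr (w : nat -> V) k : w @ \oo --> k ->
    `|w n| ^+ 2 @[n --> \oo] --> `|k| ^+ 2.
  by move=> wk; rewrite expr2; apply: cvgM; exact: cvg_norm.
apply: cvgM; first exact: cvg_cst.
by apply: cvgB; [apply: cvgB|]; apply: sqr => //; exact: cvgD.
Qed.

(** Cauchy-Schwarz for b gives <f, f>^2 = (b f g)^2 <= b f f * b g g, and b g g
is at most K <f, f>. It is used with g a preimage of f under the operator that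
represents b. *)
Lemma coercive_of_right_inverse D b f g K : psd_form D b -> D f -> D g ->
  0 <= K -> b f g = dot f f -> b g g <= K * dot f f -> dot f f <= K * b f f.
Proof.
move=> B Df Dg K0 fg gK; have := psd_Cauchy_Schwarz B Df Dg; rewrite fg.
have bf := psd_ge0 B Df; have: 0 <= dot f f by rewrite -V_hilbert sqr_ge0.
rewrite le_eqVlt => /predU1P[<- _|ff_gt0 CS]; first by rewrite mulr_ge0.
rewrite -(ler_pM2r ff_gt0) -expr2 (le_trans CS)// mulrAC mulrC.
by rewrite ler_wpM2r.
Qed.

(** * Partial operators *)

Lemma op_domainZ A a f : op_domain A f -> op_domain A (a *: f).
Proof.
by move=> Df; have := op_domain_linear a Df (op_domain_zero A); rewrite addr0.
Qed.

Lemma op_domainD A f g :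
  op_domain A f -> op_domain A g -> op_domain A (f + g).
Proof. by move=> Df Dg; rewrite -[f]scale1r; exact: op_domain_linear. Qed.

Lemma op_domainB A f g :
  op_domain A f -> op_domain A g -> op_domain A (f - g).
Proof.
by move=> Df Dg; rewrite -scaleN1r; apply: op_domainD => //; exact: op_domainZ.
Qed.

Lemma op_action0 A : A 0 = 0.
Proof.
have A0 := op_domain_zero A; have := op_action_linear 1 A0 A0.
by rewrite !scale1r addr0 => /eqP; rewrite -subr_eq subrr => /eqP.
Qed.

Lemma op_actionZ A a f : op_domain A f -> A (a *: f) = a *: A f.
Proof.
move=> Df; have := op_action_linear a Df (op_domain_zero A).
by rewrite op_action0 !addr0.
Qed.

Lemma op_actionD A f g :
  op_domain A f -> op_domain A g -> A (f + g) = A f + A g.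
Proof.
by move=> Df Dg; rewrite -[f in LHS]scale1r op_action_linear// scale1r.
Qed.

Lemma op_actionB A f g :
  op_domain A f -> op_domain A g -> A (f - g) = A f - A g.
Proof.
move=> Df Dg; rewrite -scaleN1r op_actionD ?op_actionZ ?scaleN1r//.
by rewrite -scaleN1r; exact: op_domainZ.
Qed.

Definition symmetric_op A : Prop := forall f g,
  op_domain A f -> op_domain A g -> dot (A f) g = dot f (A g).

Lemma self_adjointP A : self_adjoint dot A <-> forall u v,
  (op_domain A u /\ v = A u) <->
  (forall f, op_domain A f -> dot (A f) u = dot f v).
Proof.
split=> [sa u v|sa]; last by apply/seteqP; split=> -[u v] /sa.
by have : op_graph A (u, v) <-> op_adjoint_graph dot A (u, v) by rewrite sa.
Qed.

Lemma self_adjoint_symmetric A : self_adjoint dot A -> symmetric_op A.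
Proof.
move=> /self_adjointP sa f g Df Dg.
by have [+ _] := sa g (A g); apply.
Qed.

(** Both adjoint relations are the same after moving T from one side of the
inner product to the other. *)
Lemma self_adjoint_perturbation A T :
  (forall f g, dot (T f) g = dot f (T g)) ->
  self_adjoint dot A -> self_adjoint dot (perturbation A T).
Proof.
move=> Tsym /self_adjointP sa; apply/self_adjointP => u v.
have -> : (op_domain (perturbation A T) u /\ v = perturbation A T u) <->
    (op_domain A u /\ v - T u = A u).
  by split=> -[Du /= uv]; split=> //=; [rewrite uv addrK|rewrite -uv subrK].
rewrite sa; split=> adj f Df /=; have := adj f Df.
- by rewrite /= dotDl Tsym => ->; rewrite !dotE subrK.
- by rewrite /= dotDl Tsym dotDr dotNr => <-; rewrite addrK.
Qed.

Lemma quadratic_form_psd A : symmetric_op A -> positive_semidefinite dot A ->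
  psd_form (op_domain A) (fun f g => dot f (A g)).
Proof.
move=> sym psd; split=> [a f g|a f g h Df Dg Dh|f g Df Dg|f Df].
- exact: op_domain_linear.
- by rewrite !dotE.
- by rewrite -sym// dotC.
- exact: psd.
Qed.

Lemma bounded_opP T : bounded_op T ->
  exists2 K, 0 <= K & forall f, `|T f| <= K * `|f|.
Proof.
move=> /linear_boundedP/pinfty_ex_gt0[K K0 TK].
by exists K; [exact: ltW|].
Qed.

(** * Resolvents and lower bounds *)

(** Let r0 be the best constant in r0 |f| <= |(A - c) f|, and suppose r0 < r.
The form b f g = <(A - c) f, (A - c) g> - r0^2 <f, g> is positive semi-definite
and is represented by (A - c - r0)(A - c + r0), which has a bounded right
inverse since c - r0 and c + r0 are in the resolvent set. So b is coercive,
which improves the constant r0. *)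
Lemma resolvent_dist A c r : symmetric_op A ->
  (forall s, 0 <= s -> s < r ->
    resolvent_set A (c - s) /\ resolvent_set A (c + s)) ->
  forall f, op_domain A f -> r * `|f| <= `|A f - c *: f|.
Proof.
move=> sym res f Df; rewrite leNgt; apply/negP => f_lt.
have f0 : 0 < `|f|.
  rewrite normr_gt0; apply/eqP => f0; move: f_lt.
  by rewrite f0 op_action0 scaler0 subr0 normr0 mulr0 ltxx.
pose E := [set s : R | 0 <= s /\
  forall g, op_domain A g -> s * `|g| <= `|A g - c *: g|].
have E0 : E 0 by split=> // g _; rewrite mul0r.
have Ele s : E s -> s <= `|A f - c *: f| / `|f|.
  by move=> [_ /(_ f Df)]; rewrite ler_pdivlMr.
have supE : has_sup E.
  by split; [exists 0|exists (`|A f - c *: f| / `|f|); exact: Ele].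
set r0 := sup E; have r0_ge0 : 0 <= r0 by exact: sup_upper_bound.
have r0_lt : r0 < r.
  apply: (@le_lt_trans _ _ (`|A f - c *: f| / `|f|)).
    by apply: ge_sup; [exists 0|move=> s /Ele].
  by rewrite ltr_pdivrMr.
have lower g : op_domain A g -> r0 * `|g| <= `|A g - c *: g|.
  move=> Dg; have [->|g0] := eqVneq g 0; first by rewrite normr0 mulr0.
  rewrite -ler_pdivlMr ?normr_gt0//; apply: ge_sup; first by exists 0.
  by move=> s [_ /(_ g Dg)]; rewrite ler_pdivlMr ?normr_gt0.
(* T1 inverts A - (c + r0), and T2 inverts A - (c - r0). *)
have [[T2 [/bounded_opP[K2 K20 T2K] T2D T2r _]]
  [T1 [/bounded_opP[K1 K10 T1K] T1D T1r _]]] := res _ r0_ge0 r0_lt.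
pose b g h := dot (A g - c *: g) (A h - c *: h) - r0 ^+ 2 * dot g h.
have b_psd : psd_form (op_domain A) b.
  split=> [a g h|a g h k Dg Dh Dk|g h Dg Dh|g Dg].
  - exact: op_domain_linear.
  - rewrite /b op_action_linear// !dotE; ring.
  - by rewrite /b dotC (dotC g).
  - rewrite /b -!V_hilbert subr_ge0 -exprMn ler_sqr ?nnegrE ?mulr_ge0//.
    exact: lower.
pose K := K1 + r0 * K2 * K1 + 1.
have K0 : 0 < K by rewrite /K ltr_wpDl// addr_ge0// !mulr_ge0.
(* K bounds the map that takes h to (A - c) (T2 (T1 h)). *)
have coer h : op_domain A h -> dot h h <= K ^+ 2 * b h h.
  move=> Dh; pose h1 := T1 h; pose g := T2 h1.
  have Ag : A g - c *: g = h1 - r0 *: g.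
    by rewrite -(T2r h1) -/g scalerBl opprB addrA addrAC addrK.
  have Ah1 : A h1 = h + c *: h1 + r0 *: h1.
    by rewrite -{1}(T1r h) -/h1 scalerDl -addrA subrK.
  have Dg : op_domain A g by exact: T2D.
  have Dh1 : op_domain A h1 by exact: T1D.
  have h1K : `|h1| <= K1 * `|h| by exact: T1K.
  have gK : `|g| <= K2 * `|h1| by exact: T2K.
  apply: (coercive_of_right_inverse b_psd Dh Dg); first exact: sqr_ge0.
  - have Agh : A g = h1 - r0 *: g + c *: g by rewrite -Ag subrK.
    rewrite /b Ag !dotE sym// sym// Ah1 Agh !dotE; ring.
  - rewrite /b Ag -!V_hilbert -!exprMn.
    rewrite (@le_trans _ _ (`|h1 - r0 *: g| ^+ 2))//.
      by rewrite lerBlDr lerDl sqr_ge0.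
    rewrite ler_sqr ?nnegrE ?mulr_ge0 ?(ltW K0)//.
    rewrite (le_trans (ler_normB _ _))// normrZ (ger0_norm r0_ge0).
    have := ler_wpM2l r0_ge0 gK; have := ler_wpM2l r0_ge0 (ler_wpM2l K20 h1K).
    by rewrite /K !mulrDl; have := normr_ge0 h; lra.
have K2_gt0 : 0 < (K ^+ 2)^-1 by rewrite invr_gt0 exprn_gt0.
pose r1 := Num.sqrt (r0 ^+ 2 + (K ^+ 2)^-1).
have r1sq : r1 ^+ 2 = r0 ^+ 2 + (K ^+ 2)^-1.
  by rewrite sqr_sqrtr// addr_ge0 ?sqr_ge0 ?ltW.
have Er1 : E r1.
  split=> [|g Dg]; first exact: sqrtr_ge0.
  rewrite -ler_sqr ?nnegrE ?mulr_ge0 ?sqrtr_ge0// exprMn r1sq.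
  have := coer g Dg; rewrite mulrC -ler_pdivrMr ?exprn_gt0// /b -!V_hilbert.
  by rewrite mulrDl [_^-1 * _]mulrC; lra.
have : r1 <= r0 by exact: sup_upper_bound.
by rewrite -ler_sqr ?nnegrE ?sqrtr_ge0// r1sq gerDl leNgt K2_gt0.
Qed.

(** With c = m - t, the distance bound says t^2 |f|^2 <= |(A - m) f + t f|^2,
that is 0 <= |(A - m) f|^2 + 2 t <f, (A - m) f> for all t > 0; large t
concludes. *)
Lemma form_ge_resolvent_below A m : symmetric_op A ->
  (forall z, z < m -> resolvent_set A z) ->
  forall f, op_domain A f -> m * dot f f <= dot f (A f).
Proof.
move=> sym res f Df; rewrite leNgt; apply/negP => q_lt.
set q := m * dot f f - dot f (A f).
have q0 : 0 < q by rewrite subr_gt0.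
pose N := dot (A f - m *: f) (A f - m *: f).
have N0 : 0 <= N by rewrite /N -V_hilbert sqr_ge0.
(* This value of t turns N - 2 t q into - N - 2 < 0. *)
pose t := (N + 1) / q.
have t0 : 0 < t by rewrite divr_gt0// ltr_wpDl.
have : t * `|f| <= `|A f - (m - t) *: f|.
  by apply: resolvent_dist => // s s0 st; split; apply: res; lra.
rewrite -ler_sqr ?nnegrE ?(mulr_ge0 (ltW t0))// exprMn !V_hilbert.
have -> : dot (A f - (m - t) *: f) (A f - (m - t) *: f) =
    N - 2 * (t * q) + t ^+ 2 * dot f f.
  by rewrite /N /q !dotE (dotC (A f) f); ring.
have -> : t * q = N + 1 by rewrite /t divfK// gt_eqF.
by lra.
Qed.

(** This is [resolvent_dist] at the middle nu / 2 of the gap, with the square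
expanded: A (A - nu) >= 0. *)
Lemma form_gap A nu : symmetric_op A -> 0 < nu ->
  (forall z, 0 < z -> z < nu -> resolvent_set A z) ->
  forall f, op_domain A f -> nu * dot f (A f) <= dot (A f) (A f).
Proof.
move=> sym nu0 res f Df; pose c := nu / 2.
have nuE : nu = 2 * c by rewrite /c; lra.
have c0 : 0 <= c by rewrite /c; lra.
have : c * `|f| <= `|A f - c *: f|.
  by apply: resolvent_dist => // s s0 st; split; apply: res; lra.
rewrite -ler_sqr ?nnegrE ?(mulr_ge0 c0)// exprMn !V_hilbert nuE.
by rewrite !dotE (dotC (A f) f); lra.
Qed.

(** * Spectral gap above an eigenvalue *)

Lemma cauchy_harmonic (u : nat -> V) (C : R) : 0 < C ->
  (forall n m, `|u n - u m| <= C * (harmonic n + harmonic m)) ->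
  exists l : V, u @ \oo --> l.
Proof.
move=> C0 uC; apply/cvg_ex; apply/cauchy_cvgP/cauchy_ballP => e e0.
have e'0 : 0 < e / C / 2 by rewrite !divr_gt0.
have small : \forall n \near \oo, `|@harmonic R n| < e / C / 2.
  exact: (cvgr0_norm_lt _ cvg_harmonic).
near_simpl; near=> n m; rewrite -ball_normE /=.
apply: le_lt_trans (uC _ _) _.
rewrite -ltr_pdivlMl// mulrC [e / C](splitr (e / C)) ltrD//.
- by apply: le_lt_trans (ler_norm _) _; near: n.
- by apply: le_lt_trans (ler_norm _) _; near: m.
Unshelve. all: by end_near. Qed.

(** By Cauchy-Schwarz for the form of A, a sequence with <u, A u> tending to 0
satisfies <A f, u> -> 0 for every f in the domain. So the limit is orthogonal
to the range of A, and self-adjointness puts it in the domain, with image 0. *)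
Lemma kernel_of_minimizing A (u : nat -> V) l :
  self_adjoint dot A -> positive_semidefinite dot A ->
  (forall n, op_domain A (u n)) -> u @ \oo --> l ->
  dot (u n) (A (u n)) @[n --> \oo] --> 0 -> op_domain A l /\ A l = 0.
Proof.
move=> sa psd Du ul form0.
have sym := self_adjoint_symmetric sa.
suff : op_domain A l /\ 0 = A l by move=> [].
apply/((self_adjointP A).1 sa) => f Df; rewrite dot0r.
apply/eqP; rewrite -sqrf_eq0 eq_le sqr_ge0 andbT.
have bound n : dot (A f) (u n) * dot (A f) (u n) <=
    dot f (A f) * dot (u n) (A (u n)).
  rewrite -expr2 sym//.
  exact: psd_Cauchy_Schwarz (quadratic_form_psd sym psd) _ _.
have fl : dot (A f) (u n) @[n --> \oo] --> dot (A f) l.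
  by apply: (@dot_cvg (fun=> A f)) => //; exact: cvg_cst.
have f0 : dot f (A f) * dot (u n) (A (u n)) @[n --> \oo] --> dot f (A f) * 0.
  by apply: cvgM => //; exact: cvg_cst.
have := @ler_cvg_to _ \oo _ R _ _ _ _ (cvgM fl fl) f0.
by rewrite mulr0 -expr2; apply; exact: nearW.
Qed.

(** With this, the lowest eigenvalue can be assumed to be 0. *)
Lemma resolvent_shift A m z : resolvent_set A (m + z) ->
  resolvent_set (perturbation A (GRing.scale (- m))) z.
Proof.
have shiftE f : A f - m *: f - z *: f = A f - (m + z) *: f.
  by rewrite scalerDl opprD addrA.
move=> [T [Tb TD Tr Tl]]; exists T; split=> // [g|f Df] /=.
- by rewrite scaleNr shiftE Tr.
- by rewrite scaleNr shiftE Tl.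
Qed.

(** Cauchy-Schwarz with the vectors A g and g: here <A g, A g> is the value of
the form of A at this pair, and <g, A g> <= |A g|^2 / nu. *)
Lemma form_gap_range A nu g : self_adjoint dot A ->
  positive_semidefinite dot A -> 0 < nu ->
  (forall f, op_domain A f -> nu * dot f (A f) <= dot (A f) (A f)) ->
  op_domain A g -> op_domain A (A g) ->
  nu * dot (A g) (A g) <= dot (A g) (A (A g)).
Proof.
move=> sa psd nu0 gap Dg DAg; have sym := self_adjoint_symmetric sa.
have := coercive_of_right_inverse (quadratic_form_psd sym psd) DAg Dg.
move=> /(_ nu^-1); rewrite invr_ge0 (ltW nu0) => /(_ isT erefl).
by rewrite !ler_pdivlMl//; apply; exact: gap.
Qed.

(** For small eps > 0 put h = - eps (A - eps)^-1 f. Then f - h is in the range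
of A, where A >= nu, so it is enough that h -> 0 with A h -> 0 as eps -> 0.
Since |h| <= |f|, the vector A h = eps (h - f) tends to 0. Differences of two
such h are in the range of A, where |A k| >= nu |k|; so h is Cauchy. Its limit
is in the kernel of A, which phi spans, and is orthogonal to phi as f is. *)
Lemma form_gap_orthogonal A nu phi : self_adjoint dot A ->
  positive_semidefinite dot A -> 0 < nu ->
  (forall z, 0 < z -> z < nu -> resolvent_set A z) ->
  op_domain A phi -> dot phi phi = 1 -> A phi = 0 ->
  (forall f, op_domain A f -> A f = 0 -> exists a, f = a *: phi) ->
  forall f, op_domain A f -> dot phi f = 0 -> nu * dot f f <= dot f (A f).
Proof.
move=> sa psd nu0 res Dphi phi1 Aphi ker f Df phif.
have sym := self_adjoint_symmetric sa.
have gap := form_gap sym nu0 res.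
have approx eps : 0 < eps -> eps <= nu / 2 -> exists h g,
    [/\ op_domain A h, op_domain A g, f - h = A g, A h = eps *: (h - f) &
        `|h| <= `|f| /\ dot phi h = 0].
  move=> eps0 epsnu; have [|T [_ TD Tr _]] := res _ eps0; first by lra.
  pose g := T f; have Ag : A g = f + eps *: g by rewrite -{1}(Tr f) subrK.
  have Dg : op_domain A g by exact: TD.
  have [h hE] : exists h, h = - eps *: g by exists (- eps *: g).
  have Dh : op_domain A h by rewrite hE; exact: op_domainZ.
  have Ah : A h = eps *: (h - f).
    by rewrite hE op_actionZ// Ag !scaleNr -scalerN opprD addrC.
  exists h, g; split=> //; first by rewrite hE scaleNr opprK.
  split.
    rewrite -ler_sqr ?nnegrE// !V_hilbert -(ler_pM2l (exprn_gt0 2 eps0)).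
    have -> : eps ^+ 2 * dot f f = dot (A h - eps *: h) (A h - eps *: h).
      by rewrite Ah scalerBr [_ - _ *: f]addrC addrK !dotE; ring.
    have := gap h Dh; have := psd h Dh; rewrite !dotE (dotC (A h) h).
    move: (dot h (A h)) (dot (A h) (A h)) (dot h h) => x y w x0 xy.
    have : eps * x <= nu / 2 * x by exact: ler_wpM2r.
    lra.
  have := sym _ _ Dphi Dh; rewrite Aphi dot0l Ah !dotE phif subr0 => /esym/eqP.
  by rewrite mulf_eq0 gt_eqF//= => /eqP.
(* The bound |h| <= |f| needs eps <= nu / 2. *)
pose eps n : R := nu / 2 * harmonic n.
have eps0 n : 0 < eps n by rewrite mulr_gt0 ?harmonic_gt0// divr_gt0.
have epsnu n : eps n <= nu / 2.
  by rewrite ger_pMr ?divr_gt0// invf_le1 ?ltr0n// ler1n.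
have eps_cvg : eps @ \oo --> 0.
  rewrite -(mulr0 (nu / 2)); apply: cvgM cvg_harmonic; exact: cvg_cst.
have /choice[h /choice[g hg]] n := approx _ (eps0 n) (epsnu n).
have Dh n : op_domain A (h n) by case: (hg n).
have Ah n : A (h n) = eps n *: (h n - f) by case: (hg n).
have Ah_le n : `|A (h n)| <= eps n * (2 * `|f|).
  have [_ _ _ -> [hf _]] := hg n; rewrite normrZ gtr0_norm// ler_pM2l//.
  by rewrite (le_trans (ler_normB _ _))//; lra.
have rangeA n : exists2 u, op_domain A u & f - h n = A u.
  by have [_ Du eqA _ _] := hg n; exists (g n).
have [l hl] : exists l : V, h @ \oo --> l.
  apply: (@cauchy_harmonic _ (`|f| + 1)); first by rewrite ltr_wpDl.
  move=> n m; have [u Du hu] := rangeA n; have [v Dv hv] := rangeA m.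
  have nmE : h n - h m = A (v - u).
    by rewrite op_actionB// -hu -hv opprB [RHS]addrC addrA subrK.
  have := form_gap_range sa psd nu0 gap (op_domainB Dv Du).
  rewrite -nmE => /(_ (op_domainB (Dh n) (Dh m))).
  move=> /le_trans /(_ (dot_le _ _)); rewrite -V_hilbert expr2 mulrA.
  have [->|nm0 nuA] := eqVneq (h n - h m) 0.
    by rewrite normr0 mulr_ge0 ?addr_ge0 ?harmonic_ge0.
  have : nu * `|h n - h m| <= `|A (h n - h m)|.
    by rewrite -(@ler_pM2r _ `|h n - h m|) ?normr_gt0// [leRHS]mulrC.
  rewrite op_actionB// => /le_trans /(_ (ler_normB _ _)).
  move=> /le_trans /(_ (lerD (Ah_le n) (Ah_le m))).
  move=> nu_le; rewrite -(ler_pM2l nu0); apply: le_trans nu_le _; rewrite /eps.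
  have := @harmonic_ge0 R n; have := @harmonic_ge0 R m.
  move: (harmonic n) (harmonic m) => x y x0 y0.
  by have := mulr_ge0 (ltW nu0) (addr_ge0 x0 y0); lra.
have Ah0 : (fun n => A (h n)) @ \oo --> 0.
  apply: norm_cvg0; apply: (@squeeze_cvgr _ _ _ _ (cst 0)
    (fun n => eps n * (2 * `|f|))).
  - by apply: nearW => n; rewrite normr_ge0 Ah_le.
  - exact: cvg_cst.
  - by rewrite -(mul0r (2 * `|f|)); apply: cvgM => //; exact: cvg_cst.
have [Dl Al] : op_domain A l /\ A l = 0.
  by apply: (kernel_of_minimizing sa psd Dh hl); rewrite -(dot0r l);
     exact: dot_cvg.
have l0 : l = 0.
  have phil : dot phi l = 0.
    have : dot phi (h n) @[n --> \oo] --> dot phi l.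
      by apply: (@dot_cvg (fun=> phi)) => //; exact: cvg_cst.
    have -> : (fun n => dot phi (h n)) = cst 0.
      by apply/funext => n; have [_ _ _ _ []] := hg n.
    by move=> /(cvg_unique _ (cvg_cst 0)) <-.
  have [a la] := ker _ Dl Al; move: phil; rewrite la dotZr phi1 mulr1 => ->.
  by rewrite scale0r.
have fh : (fun n => f - h n) @ \oo --> f.
  have : f - h n @[n --> \oo] --> f - l by apply: cvgB => //; exact: cvg_cst.
  by rewrite l0 subr0.
have Afh : (fun n => A (f - h n)) @ \oo --> A f.
  under eq_fun do rewrite op_actionB//.
  have : A f - A (h n) @[n --> \oo] --> A f - 0.
    by apply: cvgB => //; exact: cvg_cst.
  by rewrite subr0.
have lim1 : nu * dot (f - h n) (f - h n) @[n --> \oo] --> nu * dot f f.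
  by apply: cvgM; [exact: cvg_cst|exact: dot_cvg].
have := @ler_cvg_to _ \oo _ R _ _ _ _ lim1 (dot_cvg fh Afh).
apply; apply: nearW => n; have [u Du hu] := rangeA n; rewrite hu.
by apply: form_gap_range => //; rewrite -hu; exact: op_domainB.
Qed.

(** * The ground state of the perturbed operator *)

(** The hypotheses say that 0 is the infimum of the form of B on unit vectors
and that the form is bounded below by delta on the orthogonal complement of
phi. Scaling to <phi, u> = 1 makes u n - u m orthogonal to phi, so that
coercivity applies to it. *)
Lemma min_eigenvector B phi delta : self_adjoint dot B ->
  positive_semidefinite dot B -> 0 < delta ->
  op_domain B phi -> dot phi phi = 1 ->
  (forall f, op_domain B f -> dot phi f = 0 ->
    delta * dot f f <= dot f (B f)) ->
  (forall e, 0 < e -> exists f,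
    [/\ op_domain B f, dot f f = 1 & dot f (B f) <= e]) ->
  exists u, [/\ op_domain B u, B u = 0 & dot phi u = 1].
Proof.
move=> sa psd delta0 Dphi phi1 coer minim.
have b_psd := quadratic_form_psd (self_adjoint_symmetric sa) psd.
pose beta := dot phi (B phi); have beta0 : 0 <= beta by exact: psd.
(* A unit vector f with <f, B f> <= delta / 4 satisfies kappa <= <phi, f>^2:
   were f almost orthogonal to phi, coercivity would contradict the small
   value. *)
pose kappa := delta / 2 / (2 * beta + delta).
have kappa0 : 0 < kappa by rewrite !divr_gt0// ltr_wpDl// mulr_ge0.
have normalized e : 0 < e -> exists u,
    [/\ op_domain B u, dot phi u = 1 & dot u (B u) <= e ^+ 2].
  move=> e0.
  have [|f [Df f1 fB]] := minim (Num.min (delta / 4) (kappa * e ^+ 2)).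
    by rewrite lt_min divr_gt0// mulr_gt0// exprn_gt0.
  move: fB; rewrite le_min => /andP[fB1 fB2].
  pose a := dot phi f.
  have Daphi : op_domain B (a *: phi) by exact: op_domainZ.
  have Dg := op_domainB Df Daphi.
  have kappa_a : kappa <= a ^+ 2.
    have := coer _ Dg; rewrite dotDr dotNr dotZr phi1 mulr1 subrr => /(_ erefl).
    move=> /le_trans /(_ (psd_sub_le b_psd Df Daphi)) /=.
    rewrite op_actionZ// !dotE f1 phi1 (dotC f) -/a -/beta => le1.
    by rewrite /kappa ler_pdivrMr ?ltr_wpDl ?mulr_ge0//; nra.
  have a_neq0 : a != 0 by rewrite -sqrf_eq0 gt_eqF// (lt_le_trans kappa0).
  exists (a^-1 *: f); split; first exact: op_domainZ.
    by rewrite dotZr mulVf.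
  rewrite op_actionZ// dotZl dotZr mulrA -invfM -expr2 mulrC.
  rewrite ler_pdivrMr ?exprn_even_gt0// (le_trans fB2)// mulrC.
  by rewrite ler_wpM2l// sqr_ge0.
have /choice[u hu] n := normalized _ (@harmonic_gt0 R n).
have Du n : op_domain B (u n) by case: (hu n).
have [l ul] : exists l : V, u @ \oo --> l.
  (* delta |u n - u m|^2 <= 2 (x^2 + y^2) <= 2 (x + y)^2 with x, y harmonic. *)
  apply: (@cauchy_harmonic _ (Num.sqrt (2 / delta))).
    by rewrite sqrtr_gt0 divr_gt0.
  move=> n m.
  rewrite -ler_sqr ?nnegrE ?mulr_ge0 ?addr_ge0 ?sqrtr_ge0 ?harmonic_ge0//.
  rewrite exprMn sqr_sqrtr ?divr_ge0 ?(ltW delta0)// V_hilbert.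
  rewrite -mulrA mulrCA ler_pdivlMl//.
  have := coer _ (op_domainB (Du n) (Du m)).
  have [_ un1 bn] := hu n; have [_ um1 bm] := hu m.
  rewrite dotDr dotNr un1 um1 subrr => /(_ erefl) /le_trans; apply.
  apply: le_trans (psd_sub_le b_psd (Du n) (Du m)) _.
  have := @harmonic_ge0 R n; have := @harmonic_ge0 R m; nra.
have bu0 : dot (u n) (B (u n)) @[n --> \oo] --> 0.
  apply: (@squeeze_cvgr _ _ _ _ (cst 0) (fun n => @harmonic R n * harmonic n)).
  - by apply: nearW => n; rewrite psd//=; have [_ _] := hu n; rewrite expr2.
  - exact: cvg_cst.
  - by rewrite -[X in _ --> X](mulr0 0); apply: cvgM; exact: cvg_harmonic.
have [Dl Bl] := kernel_of_minimizing sa psd Du ul bu0.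
exists l; split=> //.
have : dot phi (u n) @[n --> \oo] --> dot phi l.
  by apply: (@dot_cvg (fun=> phi)) => //; exact: cvg_cst.
have -> : (fun n => dot phi (u n)) = cst 1.
  by apply/funext => n; have [] := hu n.
move=> lim1; apply: (cvg_unique _ lim1) => //; exact: cvg_cst.
Qed.

Lemma kernel_unique B phi delta psi psi' : 0 < delta ->
  (forall f, op_domain B f -> dot phi f = 0 ->
    delta * dot f f <= dot f (B f)) ->
  op_domain B psi -> B psi = 0 -> dot psi psi = 1 ->
  op_domain B psi' -> B psi' = 0 -> dot psi' psi' = 1 ->
  psi' = psi \/ psi' = - psi.
Proof.
move=> delta0 coer D1 B1 n1 D2 B2 n2.
pose a := dot phi psi; pose a' := dot phi psi'.
have a0 : a != 0.
  apply/eqP => /(coer _ D1); rewrite B1 dot0r n1 mulr1.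
  by rewrite leNgt delta0.
have Dd := op_domainB (op_domainZ a' D1) (op_domainZ a D2).
have := coer _ Dd; rewrite op_actionB ?op_actionZ//; [|exact: op_domainZ..].
rewrite B1 B2 !scaler0 subrr dot0r dotDr dotNr !dotZr -/a -/a' mulrC subrr.
move=> /(_ erefl); rewrite pmulr_rle0// -V_hilbert => d0.
have : `|a' *: psi - a *: psi'| ^+ 2 == 0 by rewrite eq_le d0 sqr_ge0.
rewrite expf_eq0/= normr_eq0 subr_eq0 => /eqP eqd.
have : a' ^+ 2 = a ^+ 2.
  have := congr1 (fun v => dot v v) eqd.
  by rewrite !dotE n1 n2 !mulr1 -!expr2.
move=> /eqP; rewrite eqf_sqr => /orP[] /eqP aa.
- by left; apply: (scalerI a0); rewrite -eqd aa.
- by right; apply: (scalerI a0); rewrite -eqd aa scaleNr scalerN.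
Qed.

(** The part g of psi orthogonal to phi satisfies delta |g| <= a |w|, where a
is the cosine of the angle between phi and psi; the multiple t phi of phi is
not seen by g. As |g|^2 = 1 - a^2 and |phi - psi|^2 = 2 - 2 a, the claim
reduces to (2 - 2 a) a^2 <= 1 - a^2 for 0 <= a <= 1. *)
Lemma kernel_dist B phi delta w t psi : symmetric_op B -> 0 < delta ->
  op_domain B phi -> dot phi phi = 1 -> B phi = w + t *: phi ->
  (forall f, op_domain B f -> dot phi f = 0 ->
    delta * dot f f <= dot f (B f)) ->
  op_domain B psi -> B psi = 0 -> dot psi psi = 1 -> 0 <= dot phi psi ->
  delta * `|phi - psi| <= `|w|.
Proof.
move=> sym delta0 Dphi phi1 Bphi coer Dpsi Bpsi psi1.
set a := dot phi psi => a_ge0.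
pose g := psi - a *: phi.
have Dg : op_domain B g by apply: op_domainB => //; exact: op_domainZ.
have phig : dot phi g = 0 by rewrite /g dotDr dotNr dotZr phi1 mulr1 subrr.
have gg : dot g g = 1 - a ^+ 2.
  by rewrite /g !dotE psi1 phi1 (dotC psi) -/a; ring.
have Bg : dot g (B g) = - (a * dot g w).
  have -> : B g = - (a *: (w + t *: phi)).
    rewrite /g op_actionB ?op_actionZ// ?Bpsi ?sub0r ?Bphi//.
    exact: op_domainZ.
  by rewrite dotNr dotZr dotDr dotZr (dotC g phi) phig mulr0 addr0.
have tangent : delta * `|g| <= a * `|w|.
  have := coer g Dg phig; rewrite Bg -V_hilbert.
  have [->|g0] := eqVneq g 0; first by rewrite normr0 mulr0 mulr_ge0.
  have g_gt0 : 0 < `|g| by rewrite normr_gt0.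
  move=> le1; rewrite -(ler_pM2r g_gt0) -[leLHS]mulrA -expr2.
  rewrite (le_trans le1)// -mulrN -dotNl -[leRHS]mulrA.
  by rewrite ler_wpM2l// (le_trans (dot_le _ _))// normrN mulrC.
have tangent2 : delta ^+ 2 * (1 - a ^+ 2) <= a ^+ 2 * `|w| ^+ 2.
  rewrite -gg -V_hilbert -!exprMn ler_sqr ?nnegrE ?mulr_ge0//.
  exact: ltW.
have a_gt0 : 0 < a.
  rewrite lt_neqAle a_ge0 andbT eq_sym; apply/eqP => a0; move: tangent2.
  by rewrite a0 expr0n/= subr0 mul0r mulr1 leNgt exprn_gt0.
have a_le1 : a <= 1.
  by have : 0 <= 1 - a ^+ 2; [rewrite -gg -V_hilbert sqr_ge0|nra].
rewrite -ler_sqr ?nnegrE ?mulr_ge0 ?(ltW delta0)// exprMn V_hilbert.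
have -> : dot (phi - psi) (phi - psi) = 2 - 2 * a.
  by rewrite !dotE phi1 psi1 (dotC psi) -/a; ring.
rewrite -(ler_pM2l (exprn_gt0 2 a_gt0)) (le_trans _ tangent2)//.
rewrite mulrCA ler_pM2l ?exprn_gt0//.
(* 1 - a^2 - (2 - 2 a) a^2 = (1 - a)^2 (1 + 2 a). *)
have : 0 <= (1 - a) * ((1 - a) * (1 + 2 * a)).
  by apply: mulr_ge0; [lra|apply: mulr_ge0; lra].
by lra.
Qed.

Lemma op_norm_le T f : bounded_op T -> `|T f| <= op_norm T * `|f|.
Proof.
move=> /bounded_opP[K K0 TK].
have [->|f0] := eqVneq f 0; first by rewrite linear0 !normr0 mulr0.
have f_gt0 : 0 < `|f| by rewrite normr_gt0.
have -> : `|T f| = `|T (`|f|^-1 *: f)| * `|f|.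
  rewrite linearZ normrZ normrV ?unitfE ?gt_eqF// normr_id.
  by rewrite mulrAC mulVf ?mul1r ?gt_eqF.
rewrite ler_pM2r//; apply: sup_upper_bound.
  split; first by exists `|T 0|, 0 => //=; rewrite normr0.
  exists K => _ [g /= g1 <-]; apply: le_trans (TK g) _.
  by rewrite ler_piMr.
exists (`|f|^-1 *: f) => //=.
by rewrite normrZ normrV ?unitfE ?gt_eqF// normr_id mulVf ?gt_eqF.
Qed.

Lemma dot_unit f : `|f| = 1 -> dot f f = 1.
Proof. by rewrite -V_hilbert => ->; rewrite expr1n. Qed.

(** The lower bound m makes the infimum a true one, so that it can be used as a
lower bound and approached. *)
Lemma numerical_range_infP A phi m : op_domain A phi -> `|phi| = 1 ->
  (forall f, op_domain A f -> m * dot f f <= dot f (A f)) ->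
  let mu := numerical_range_inf dot A in
  [/\ mu <= dot phi (A phi),
      forall f, op_domain A f -> mu * dot f f <= dot f (A f) &
      forall e, 0 < e -> exists f,
        [/\ op_domain A f, dot f f = 1 & dot f (A f) <= mu + e]].
Proof.
move=> Dphi phi1 lower mu.
pose S := [set dot f (A f) | f in [set f | op_domain A f /\ `|f| = 1]].
have lb : has_lbound S.
  exists m => _ [f [Df f1] <-]; have := lower f Df.
  by rewrite dot_unit// mulr1.
have infS : has_inf S by split=> //; exists (dot phi (A phi)), phi.
split; first by apply: ge_inf => //; exists phi.
- move=> f Df; have [->|f0] := eqVneq f 0; first by rewrite !dot0l mulr0.
  have f_gt0 : 0 < `|f| by rewrite normr_gt0.
  have : mu <= dot (`|f|^-1 *: f) (A (`|f|^-1 *: f)).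
    apply: ge_inf => //; exists (`|f|^-1 *: f) => //=; split.
      exact: op_domainZ.
    by rewrite normrZ normrV ?unitfE ?gt_eqF// normr_id mulVf ?gt_eqF.
  rewrite op_actionZ// dotZl dotZr mulrA -invfM -expr2 V_hilbert.
  by rewrite ler_pdivlMl -?V_hilbert ?exprn_gt0// mulrC.
- move=> e e0; have [_ [f [Df f1] <-] lt_e] := inf_adherent e0 infS.
  by exists f; split; [|exact: dot_unit|exact: ltW].
Qed.

Lemma eigenvalue_spectrum A z phi : op_domain A phi -> A phi = z *: phi ->
  phi != 0 -> spectrum A z.
Proof.
move=> Dphi Aphi phi0 [T [_ _ _ Tl]]; move/eqP: phi0; apply.
by rewrite -(Tl phi Dphi) Aphi subrr linear0.
Qed.

(** If the spectrum is not bounded below, its infimum is 0 by convention and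
the claim is positivity. *)
Lemma form_ge_lambda0 A : symmetric_op A -> positive_semidefinite dot A ->
  spectrum A !=set0 ->
  forall f, op_domain A f -> lambda0 A * dot f f <= dot f (A f).
Proof.
move=> sym psd spec0; have [[_ lb]|out] := pselect (has_inf (spectrum A)).
  apply: form_ge_resolvent_below => // z; rewrite ltNge => z_lt.
  apply: contrapT => z_spec; move/negP: z_lt; apply.
  exact: ge_inf.
by move=> f Df; rewrite /lambda0 inf_out// mul0r; exact: psd.
Qed.

Lemma resolvent_gap A nu z : (nu%:E <= spectral_gap A)%E ->
  lambda0 A < z -> z < lambda0 A + nu -> resolvent_set A z.
Proof.
rewrite /spectral_gap leeBrDr// -EFinD addrC => gap z_gt z_lt.
apply: contrapT => z_spec.
have : (lambda1 A <= z%:E)%E.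
  apply: ereal_inf_lbound; exists z => //; split=> //.
  by apply/eqP; rewrite gt_eqF.
by move=> /(le_trans gap); rewrite lee_fin leNgt z_lt.
Qed.

Lemma form_gap_lambda0 A nu phi : self_adjoint dot A ->
  positive_semidefinite dot A -> 0 < nu -> (nu%:E <= spectral_gap A)%E ->
  one_dimensional (op_eigenspace A (lambda0 A)) ->
  unit_eigenvector A (lambda0 A) phi ->
  forall f, op_domain A f -> dot phi f = 0 ->
    (lambda0 A + nu) * dot f f <= dot f (A f).
Proof.
move=> sa psd nu0 gap [e e0 eigenE] [phi1 [Dphi Aphi]] f Df phif.
have sym := self_adjoint_symmetric sa.
have phi0 : phi != 0 by rewrite -normr_gt0 phi1.
have psd0 := form_ge_lambda0 sym psd
  (ex_intro _ _ (eigenvalue_spectrum Dphi Aphi phi0)).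
pose S := perturbation A (GRing.scale (- lambda0 A)).
have SE g : S g = A g - lambda0 A *: g by rewrite /= scaleNr.
have S_sa : self_adjoint dot S.
  by apply: self_adjoint_perturbation => // g h /=; rewrite !dotE.
have S_psd : positive_semidefinite dot S.
  by move=> g Dg; rewrite SE !dotE subr_ge0; exact: psd0.
have := form_gap_orthogonal S_sa S_psd nu0 _ Dphi (dot_unit phi1) _ _ Df phif.
rewrite (SE f) !dotE lerBrDr -mulrDl (addrC nu); apply.
- move=> z z0 znu; apply: resolvent_shift; apply: (resolvent_gap gap).
    by rewrite ltrDl.
  by rewrite ltrD2l.
- by rewrite SE Aphi subrr.
- move=> g Dg; rewrite SE => /eqP; rewrite subr_eq0 => /eqP Ag.
  have : op_eigenspace A (lambda0 A) phi by [].
  have : op_eigenspace A (lambda0 A) g by [].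
  rewrite eigenE => -[b _ <-] [a _ ae]; exists (b / a).
  rewrite -ae scalerA divfK//; apply: contra_neq phi0 => a0.
  by rewrite -ae a0 scale0r.
Qed.

(** The theorem for a real lower bound nu of the gap, with the division
cleared; an infinite gap is covered by letting nu vary. *)
Lemma ground_state_perturbation L nu phi H : self_adjoint dot L ->
  positive_semidefinite dot L -> (nu%:E <= spectral_gap L)%E ->
  one_dimensional (op_eigenspace L (lambda0 L)) ->
  unit_eigenvector L (lambda0 L) phi ->
  bounded_self_adjoint dot H -> 2 * op_norm H < nu ->
  let Lhat := perturbation L H in
  let lambdahat0 := numerical_range_inf dot Lhat in
  [/\ exists psi : V, unit_eigenvector Lhat lambdahat0 psi,
      forall psi psi' : V,
        unit_eigenvector Lhat lambdahat0 psi ->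
        unit_eigenvector Lhat lambdahat0 psi' ->
        psi' = psi \/ psi' = - psi &
      forall psi : V, unit_eigenvector Lhat lambdahat0 psi ->
        0 <= dot phi psi ->
        (nu - 2 * op_norm H) * `|phi - psi| <= `|H phi| ].
Proof.
move=> sa psd gap simple phi_eig [Hb Hsym] Hnu Lhat mu.
have [phi1 [Dphi Lphi]] := phi_eig; have phi11 := dot_unit phi1.
have sym := self_adjoint_symmetric sa.
have phi0 : phi != 0 by rewrite -normr_gt0 phi1.
have H_le f : `|H f| <= op_norm H * `|f| by exact: op_norm_le.
have H0 : 0 <= op_norm H.
  by have := H_le phi; rewrite phi1 mulr1; exact: le_trans.
have nu0 : 0 < nu by apply: le_lt_trans Hnu; rewrite mulr_ge0.
have H_form f : `|dot f (H f)| <= op_norm H * dot f f.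
  rewrite (le_trans (dot_Cauchy_Schwarz _ _))// -V_hilbert expr2 mulrA mulrC.
  by rewrite ler_wpM2r.
have form0 := form_ge_lambda0 sym psd
  (ex_intro _ _ (eigenvalue_spectrum Dphi Lphi phi0)).
have form1 := form_gap_lambda0 sa psd nu0 gap simple phi_eig.
have LhatE f : Lhat f = L f + H f by [].
have [f|mu_phi mu_le mu_inf] := @numerical_range_infP Lhat phi
  (lambda0 L - op_norm H) Dphi phi1.
  rewrite mulrBl => Df; have := form0 f Df; have := H_form f.
  by rewrite ler_norml LhatE dotDr => /andP[]; lra.
rewrite -/mu in mu_phi mu_le mu_inf.
have mu_ub : mu <= lambda0 L + op_norm H.
  have := H_form phi; move: mu_phi; rewrite LhatE dotDr Lphi dotZr phi11 !mulr1.
  by rewrite ler_norml => ? /andP[_]; lra.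
pose B := perturbation Lhat (GRing.scale (- mu)).
have BE f : B f = Lhat f - mu *: f by rewrite /= scaleNr.
have B_sa : self_adjoint dot B.
  apply: self_adjoint_perturbation; first by move=> g h /=; rewrite !dotE.
  exact: self_adjoint_perturbation.
have B_psd : positive_semidefinite dot B.
  by move=> g Dg; have := mu_le g Dg; rewrite BE LhatE !dotE; lra.
pose delta := nu - 2 * op_norm H; have delta0 : 0 < delta by rewrite subr_gt0.
(* lambda0 + nu from the gap, minus op_norm H from the perturbation, minus
   lambdahat0 <= lambda0 + op_norm H. *)
have coer f : op_domain B f -> dot phi f = 0 -> delta * dot f f <= dot f (B f).
  move=> Df phif; have := form1 f Df phif; have := H_form f.
  rewrite BE LhatE !dotE ler_norml => /andP[Hf _] Lf.
  have : mu * dot f f <= (lambda0 L + op_norm H) * dot f f.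
    by rewrite ler_wpM2r// -V_hilbert sqr_ge0.
  by rewrite /delta; lra.
have eigenP psi : unit_eigenvector Lhat mu psi <->
    [/\ op_domain B psi, B psi = 0 & `|psi| = 1].
  rewrite BE; split=> [[psi1 [Dpsi ->]]|[Dpsi /eqP Bpsi psi1]].
    by rewrite subrr.
  by split=> //; split=> //; apply/eqP; rewrite -subr_eq0.
split.
- have [e e0|u [Du Bu phiu]] :=
    min_eigenvector B_sa B_psd delta0 Dphi phi11 coer.
    have [f [Df f1 fe]] := mu_inf e e0; exists f; split=> //.
    by move: fe; rewrite BE LhatE !dotE f1; lra.
  have u0 : 0 < `|u|.
    rewrite normr_gt0; apply/eqP => u0; move: phiu.
    by rewrite u0 dot0r => /eqP; rewrite eq_sym oner_eq0.
  exists (`|u|^-1 *: u); apply/eigenP; split; first exact: op_domainZ.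
    by rewrite op_actionZ// Bu scaler0.
  by rewrite normrZ normrV ?unitfE ?gt_eqF// normr_id mulVf ?gt_eqF.
- move=> psi psi' /eigenP[D1 B1 n1] /eigenP[D2 B2 n2].
  exact: (kernel_unique delta0 coer D1 B1 (dot_unit n1) D2 B2 (dot_unit n2)).
- move=> psi /eigenP[D1 B1 n1]; move: D1 B1 (dot_unit n1).
  apply: (@kernel_dist _ _ _ _ (lambda0 L - mu)) => //.
    exact: self_adjoint_symmetric.
  by rewrite BE LhatE Lphi addrAC addrC scalerBl.
Qed.
End Hilbert.

Unset Implicit Arguments.

Theorem theorem2p1 (R : realType) (V : completeNormedModType R)
    (dot : {dot V for idfun})
    (V_hilbert : induces_norm dot)
    (V_separable : separable_space V)
    (L : partial_operator V)
    (L_dense : dense (op_domain L))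
    (L_sa : self_adjoint dot L)
    (L_psd : positive_semidefinite dot L)
    (gap_gt0 : (0 < spectral_gap L)%E)
    (L_simple : one_dimensional (op_eigenspace L (lambda0 L)))
    (phi : V)
    (phi_eigen : unit_eigenvector L (lambda0 L) phi)
    (H : {linear V -> V})
    (H_bsa : bounded_self_adjoint dot H)
    (H_small : ((op_norm H)%:E < spectral_gap L / 2%:E)%E) :
  let Lhat := perturbation L H in
  let lambdahat0 := numerical_range_inf dot Lhat in
  [/\ exists psi : V, unit_eigenvector Lhat lambdahat0 psi,
      forall psi psi' : V,
        unit_eigenvector Lhat lambdahat0 psi ->
        unit_eigenvector Lhat lambdahat0 psi' ->
        psi' = psi \/ psi' = - psi &
      forall phihat : V,
        unit_eigenvector Lhat lambdahat0 phihat ->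
        0 <= dot phi phihat ->
        (`|phi - phihat|%:E <=
           `|H phi|%:E / (spectral_gap L - (2 * op_norm H)%:E))%E].
Proof.
move=> Lhat lambdahat0.
have core nu : (nu%:E <= spectral_gap L)%E -> 2 * op_norm H < nu -> _ :=
  fun gap Hnu => ground_state_perturbation V_hilbert L_sa L_psd gap L_simple
    phi_eigen H_bsa Hnu.
case gapE : (spectral_gap L) gap_gt0 H_small core => [nu| |//] _ H_small core.
- have Hnu : 2 * op_norm H < nu.
    move: H_small; rewrite inver pnatr_eq0/= -EFinM lte_fin ltr_pdivlMr//.
    by rewrite mulrC.
  have [ex uniq bound] := core nu (lexx _) Hnu.
  split=> // psi psi_eig psi_ge0; rewrite -EFinB inver subr_eq0 gt_eqF//.
  rewrite -EFinM lee_fin ler_pdivlMr ?subr_gt0// mulrC.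
  exact: bound.
- have [|ex uniq _] := core (2 * op_norm H + 1) (leey _).
    by rewrite ltrDl.
  split=> // psi psi_eig psi_ge0; rewrite addye// invey mule0 lee_fin.
  rewrite leNgt; apply/negP => d0.
  (* For phi != phihat this nu = 2 * op_norm H + t would give
     |H phi| + 1 <= |H phi|. *)
  pose t := (`|H phi| + 1) / `|phi - psi|.
  have t0 : 0 < t by rewrite divr_gt0// ltr_wpDl.
  have [|_ _ bound] := core (2 * op_norm H + t) (leey _).
    by rewrite ltrDl.
  have := bound _ psi_eig psi_ge0.
  by rewrite [_ + t]addrC addrK divfK ?gt_eqF// gerDl ler10.
Qed.
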